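(* Let $n\in\mathbb{N}$, $r_1,\dots,r_n>0$, let $K$ be a singular and monotone kernel function, and let $J$ be an upper semicontinuous $n$-field function. Then $M(S)=m(S)$ and there exists some node system $\mathbf{w}\in\overline{S}$, also belonging to $Y$, such that it is an equioscillation point and $\underline{m}(\mathbf{w})=m(S)=M(S)=\overline{m}(\mathbf{w})$. In particular, the so-called Sandwich Property holds: for any node system $\mathbf{x}\in S$ we have $\underline{m}(\mathbf{x})\le M(S)=m(S)\le\overline{m}(\mathbf{x})$, and $M(S)=m(S)$ is the unique equioscillation value (i.e. the common value of the $m_j$ at any equioscillation point equals $M(S)=m(S)$). If in addition the kernel $K$ is strictly monotone, then the point $\mathbf{w}$ is the unique equioscillation point.
   Context: A kernel function is a function $K:(-1,0)\cup(0,1)\to\mathbb{R}$ that is concave on $(-1,0)$ and concave on $(0,1)$ and satisfies $\lim_{t\downarrow0}K(t)=\lim_{t\uparrow0}K(t)$. It is extended to $[-1,1]$, with values in $\mathbb{R}\cup\{-\infty\}$, by $K(0):=\lim_{t\to0}K(t)$, $K(-1):=\lim_{t\downarrow-1}K(t)$, $K(1):=\lim_{t\uparrow1}K(t)$. $K$ is singular if $K(0)=-\infty$; monotone if it is monotone decreasing on $(-1,0)$ and monotone increasing on $(0,1)$; strictly monotone if it is strictly decreasing on $[-1,0)$ and strictly increasing on $(0,1]$. An $n$-field function is a function $J:[0,1]\to\mathbb{R}\cup\{-\infty\}$ that is bounded above and takes finite values at more than $n$ different points, where the points $0$ and $1$ are counted with weight $1/2$ and points of $(0,1)$ with weight $1$.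 Let $S:=\{\mathbf{y}=(y_1,\dots,y_n)\in(0,1)^n: 0<y_1<\cdots<y_n<1\}$ and $\overline{S}:=\{\mathbf{y}\in[0,1]^n:0\le y_1\le\cdots\le y_n\le1\}$. For $\mathbf{y}\in\overline{S}$, $t\in[0,1]$ put $F(\mathbf{y},t):=J(t)+\sum_{j=1}^n r_jK(t-y_j)$. With $y_0:=0$, $y_{n+1}:=1$ put $I_j(\mathbf{y}):=[y_j,y_{j+1}]$ and $m_j(\mathbf{y}):=\sup_{t\in I_j(\mathbf{y})}F(\mathbf{y},t)$ for $j=0,1,\dots,n$; $\overline{m}(\mathbf{y}):=\max_{j}m_j(\mathbf{y})$, $\underline{m}(\mathbf{y}):=\min_{j}m_j(\mathbf{y})$; $M(S):=\inf_{\mathbf{x}\in S}\overline{m}(\mathbf{x})$, $m(S):=\sup_{\mathbf{x}\in S}\underline{m}(\mathbf{x})$. The regularity set is $Y:=\{\mathbf{y}\in S: m_j(\mathbf{y})\ne-\infty\text{ for }j=0,1,\dots,n\}$. A point $\mathbf{y}\in\overline{S}$ is an equioscillation point if $m_0(\mathbf{y})=m_1(\mathbf{y})=\cdots=m_n(\mathbf{y})$. *)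

(* Defs.v *)
From HB Require Import structures.
From mathcomp Require Import all_boot all_order all_algebra.
From mathcomp Require Import all_classical all_reals all_analysis.

Set Implicit Arguments.
Unset Strict Implicit.
Unset Printing Implicit Defensive.

Import Order.TTheory GRing.Theory Num.Theory.
Import numFieldNormedType.Exports.

Local Open Scope classical_set_scope.
Local Open Scope ring_scope.

Section kernels.
Context {R : realType}.

Definition concave_on (D : set R) (f : R -> R) : Prop :=
  @convex_function R R^o D (fun x => - f x).

(* A kernel has domain ]-1, 0[ `|` ]0, 1[; here it is a total function whose
   values outside that domain are never used. By concavity every limit below
   exists in \bar R and is different from +oo. *)
Definition is_kernel (K : R -> R) : Prop :=
  [/\ concave_on `]-1, 0[ K,
      concave_on `]0, 1[ K &
      lim ((K t)%:E @[t --> 0^'+]) = lim ((K t)%:E @[t --> 0^'-])].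

(* The extension of K to [-1, 1]; meaningless outside [-1, 1]. *)
Definition kernel_ext (K : R -> R) (t : R) : \bar R :=
  if t == 0 then lim ((K s)%:E @[s --> 0^'])
  else if t == -1 then lim ((K s)%:E @[s --> (-1)^'+])
  else if t == 1 then lim ((K s)%:E @[s --> 1^'-])
  else (K t)%:E.

Definition singular (K : R -> R) : Prop := kernel_ext K 0 = -oo%E.

Definition monotone_kernel (K : R -> R) : Prop :=
  {in `]-1, 0[ &, forall s t, s <= t -> K t <= K s} /\
  {in `]0, 1[ &, forall s t, s <= t -> K s <= K t}.

Definition strictly_monotone_kernel (K : R -> R) : Prop :=
  {in `[-1, 0[ &, forall s t, s < t -> (kernel_ext K t < kernel_ext K s)%E} /\
  {in `]0, 1] &, forall s t, s < t -> (kernel_ext K s < kernel_ext K t)%E}.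

End kernels.

Section fields.
Context {R : realType}.

Definition point_weight (t : R) : R :=
  if (t == 0) || (t == 1) then 2^-1 else 1.

(* Only the values of J on [0, 1] matter; boundedness above by a real number
   excludes the value +oo there. *)
Definition is_field_function (n : nat) (J : R -> \bar R) : Prop :=
  (exists B : R, forall t, t \in `[0, 1] -> (J t <= B%:E)%E) /\
  (exists s : seq R,
    [/\ uniq s,
        {in s, forall t, t \in `[0, 1] /\ J t \is a fin_num} &
        n%:R < \sum_(t <- s) point_weight t]).

(* Upper semicontinuity on A for the topology induced on A. *)
Definition upper_semicontinuous_on (A : set R) (J : R -> \bar R) : Prop :=
  forall x, A x -> forall a : R, (J x < a%:E)%E ->
    \forall y \near x, A y -> (J y < a%:E)%E.

End fields.

Section node_systems.
Context {R : realType} {n : nat}.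

Definition open_simplex : set 'rV[R]_n :=
  [set y | (forall i, 0 < y 0 i < 1) /\
           (forall i j : 'I_n, (i < j)%N -> y 0 i < y 0 j)].

Definition closed_simplex : set 'rV[R]_n :=
  [set y | (forall i, 0 <= y 0 i <= 1) /\
           (forall i j : 'I_n, (i <= j)%N -> y 0 i <= y 0 j)].

(* node y 0 = 0, node y k = y_k for 1 <= k <= n (y_k being the entry of y of
   index k - 1), and node y n.+1 = 1. *)
Definition node (y : 'rV[R]_n) (k : nat) : R :=
  if k is k'.+1 then
    if insub k' is Some i then y 0 i else 1
  else 0.

Definition node_interval (y : 'rV[R]_n) (j : 'I_n.+1) : set R :=
  `[node y j, node y j.+1]%classic.

Variables (r : 'I_n -> R) (K : R -> R) (J : R -> \bar R).

Definition sum_translates (y : 'rV[R]_n) (t : R) : \bar R :=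
  (J t + \sum_(j < n) (r j)%:E * kernel_ext K (t - y 0 j)%R)%E.

Definition local_sup (y : 'rV[R]_n) (j : 'I_n.+1) : \bar R :=
  ereal_sup [set sum_translates y t | t in node_interval y j].

Definition max_sup (y : 'rV[R]_n) : \bar R :=
  \big[maxe/-oo%E]_(j < n.+1) local_sup y j.

Definition min_sup (y : 'rV[R]_n) : \bar R :=
  \big[mine/+oo%E]_(j < n.+1) local_sup y j.

Definition minimax : \bar R := ereal_inf [set max_sup y | y in open_simplex].

Definition maximin : \bar R := ereal_sup [set min_sup y | y in open_simplex].

Definition regularity_set : set 'rV[R]_n :=
  [set y | open_simplex y /\ forall j, local_sup y j != -oo%E].

Definition equioscillation (y : 'rV[R]_n) : Prop :=
  closed_simplex y /\ forall i j, local_sup y i = local_sup y j.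

End node_systems.

(* Main.v *)
Require Import Defs.
From mathcomp Require Import all_boot all_order all_algebra.
From mathcomp Require Import all_classical all_reals all_analysis.
From mathcomp Require Import ring lra zify.

Set Implicit Arguments.
Unset Strict Implicit.
Unset Printing Implicit Defensive.

Import Order.TTheory GRing.Theory Num.Theory.
Import numFieldNormedType.Exports.

Local Open Scope classical_set_scope.
Local Open Scope ring_scope.

(** Write [F y t] for the sum of translates, [I_j y] for the interval between
the consecutive nodes [y_j] and [y_(j+1)], and [m_j y] for the supremum of
[F y] on it. Two ideas carry the proof.

Intertwining. For any two node systems [x] and [y] of the closed simplex some
index [m] satisfies [m_m y <= m_m x] (interval_sup_intertwining). Consider the
weighted displacements [c_l = \sum_(i <= l) r_i (y_i - x_i)] and let [m]
maximise [c_l] over [0 <= l <= n]. Comparing [c_m] with its two neighbours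
gives [I_m y] included in [I_m x]. On [I_m y] every node of index at most [m]
lies on the left and every other one on the right, for both systems; the
maximality of [c_m] says that the partial sums of the weighted displacements,
counted outwards from [I_m], all have the sign of nodes moving towards [I_m].
Since the two halves of [K] are concave and monotone, a weak majorization
inequality (majorization) yields [F y t <= F x t] on [I_m y]
(translates_dominated). Applied to an equioscillation point and an arbitrary
node system, in both orders, intertwining gives the Sandwich Property, hence
the equality of minimax and maximin and the uniqueness of the equioscillation
value. If [K] is strictly monotone and [c_m > c_0 = 0], the domination is
strict, which is impossible between two equioscillation points; exchanging them
shows that all [c_l] vanish, so that they coincide
(equioscillating_unique).

Existence. Let [U] be the set of the node systems of the closed simplex with
[m_0 <= m_1 <= ... <= m_n]. It is nonempty, because at [y = 0] all the [m_j]
but the last are -oo, and it is compact, because each [m_j] is continuous with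
values in the extended line (interval_sup_lsc and interval_sup_usc). Take [w]
in [U] with the largest sum of nodes. If some [m_(i-1) w < m_i w], raise the
node between the two intervals a little: this inequality persists by
continuity, and the other ones persist because, by concavity, raising a node
can only increase the difference [m_k - m_(k-1)] of two intervals on the same
side of it (off_diagonal). The raised system is in [U] with a larger sum, a
contradiction, so [w] equioscillates (equioscillation_exists). As [J] is finite
at more than [n] points, the common value is not -oo, and singularity of [K]
then forces the nodes of [w] to be distinct and different from 0 and 1. *)

(** * Concave increasing functions on ]0, 1] that tend to -oo at 0 *)

Section half_kernels.
Context {R : realType}.

(** Each half of a singular monotone kernel, read outwards from the singularity
and extended to the endpoint, satisfies this. Concavity is in the
denominator-free form of the comparison of two adjacent chords. *)
Definition half_kernel (g : R -> R) : Prop :=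
  [/\ forall p q s, 0 < p -> p < q -> q < s -> s <= 1 ->
        (g s - g q) * (q - p) <= (g q - g p) * (s - q),
      forall p q, 0 < p -> p <= q -> q <= 1 -> g p <= g q &
      forall B, exists2 d, 0 < d & forall p, 0 < p -> p < d -> g p < B].

Definition chord (g : R -> R) (a b : R) : R := (g a - g b) / (a - b).

Variable g : R -> R.
Hypothesis hg : half_kernel g.

Lemma chordC a b : chord g a b = chord g b a.
Proof. by rewrite /chord -(opprB b a) -(opprB (g b)) invrN mulrNN. Qed.

Lemma chordE a b : a != b -> g a - g b = chord g a b * (a - b).
Proof. by move=> ab; rewrite /chord divfK// subr_eq0. Qed.

Lemma chord_antitone_sorted a b a' b' :
    0 < a -> a < b -> a' < b' -> a <= a' -> b <= b' -> b' <= 1 ->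
  chord g a' b' <= chord g a b.
Proof.
case: hg => cc _ _ a0 ab ab' aa bb b1.
have st (p q s : R) : 0 < p -> p < q -> q < s -> s <= 1 ->
    chord g s q <= chord g s p /\ chord g s p <= chord g q p.
  move=> p0 pq qs s1; have := cc _ _ _ p0 pq qs s1 => h.
  rewrite /chord; have pq' : 0 < q - p by lra.
  have qs' : 0 < s - q by lra.
  have ps' : 0 < s - p by lra.
  by split; rewrite ler_pdivrMr// mulrAC ler_pdivlMr//; lra.
rewrite [leLHS]chordC [leRHS]chordC; apply: (@le_trans _ _ (chord g b' a)).
  move: aa; rewrite le_eqVlt => /predU1P[->//|aa].
  by case: (st a a' b').
move: bb; rewrite le_eqVlt => /predU1P[->//|bb].
by case: (st a b b').
Qed.

(** A chord of a concave function gets flatter when its two ends move to the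
right, whichever of them comes first. *)
Lemma chord_antitone a b a' b' :
    0 < a -> 0 < b -> a != b -> a' != b' -> a <= a' -> b <= b' ->
    a' <= 1 -> b' <= 1 ->
  chord g a' b' <= chord g a b.
Proof.
move=> a0 b0; rewrite !neq_lt => /orP[ab|ab] /orP[ab'|ab'] aa bb a1 b1.
- exact: chord_antitone_sorted.
- rewrite chordC; apply: chord_antitone_sorted => //; lra.
- rewrite [leRHS]chordC; apply: chord_antitone_sorted => //; lra.
- by rewrite chordC [leRHS]chordC; apply: chord_antitone_sorted.
Qed.

Lemma chord_ge0 a b : 0 < a -> 0 < b -> a <= 1 -> b <= 1 -> 0 <= chord g a b.
Proof.
case: hg => _ mo _ a0 b0 a1 b1; rewrite /chord.
have [ab|ba] := leP a b.
  by rewrite mulr_le0// ?invr_le0 subr_le0// mo.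
by rewrite divr_ge0// subr_ge0 ?mo// ltW.
Qed.

Lemma increment_antitone p q d :
  0 < p -> p <= q -> 0 <= d -> q + d <= 1 -> g (q + d) - g q <= g (p + d) - g p.
Proof.
move=> p0 pq; rewrite le_eqVlt => /predU1P[<-|d0] qd; first by rewrite !addr0; lra.
rewrite (@chordE (q + d) q); last lra.
rewrite (@chordE (p + d) p); last lra.
have -> : q + d - q = d by lra.
have -> : p + d - p = d by lra.
by apply: ler_wpM2r; [lra|apply: chord_antitone; lra].
Qed.

(** Abel summation without derivatives. With [C l] the head sums of the
displacements and [s i] the slope of [g] between [b i] and [a i], the sum on the
right is that of the [rho i * s i * (a i - b i)]. The slopes decrease with [i],
so by induction all the terms before the last may be charged at the last slope,
and [C N >= 0] allows replacing that slope by any smaller [q]. Letting [q] vary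
makes the induction go through. *)
Lemma majorization_slope (N : nat) (rho a b : nat -> R) :
    (forall i, (i < N)%N -> 0 <= rho i) ->
    (forall i, (i < N)%N -> 0 < a i <= 1) ->
    (forall i, (i < N)%N -> 0 < b i <= 1) ->
    (forall i j, (i <= j)%N -> (j < N)%N -> a i <= a j) ->
    (forall i j, (i <= j)%N -> (j < N)%N -> b i <= b j) ->
    (forall l, (l <= N)%N -> 0 <= \sum_(i < l) rho i * (a i - b i)) ->
  forall q, (forall i, (i < N)%N -> a i != b i -> q <= chord g (a i) (b i)) ->
  q * (\sum_(i < N) rho i * (a i - b i)) <=
    \sum_(i < N) rho i * (g (a i) - g (b i)).
Proof.
elim: N => [|N IH] r0 a01 b01 am bm C0 q hq.
  by rewrite !big_ord0 mulr0.
have {}IH := IH (fun i h => r0 i (ltnW h)) (fun i h => a01 i (ltnW h))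
  (fun i h => b01 i (ltnW h)) (fun i j h k => am i j h (ltnW k))
  (fun i j h k => bm i j h (ltnW k)) (fun l h => C0 l (leqW h)).
have := C0 N.+1 (leqnn _); rewrite !big_ord_recr /=.
have [ab|ab] := eqVneq (a N) (b N).
  rewrite ab !subrr !mulr0 !addr0 => _; apply: IH => i iN; apply: hq.
  exact: leqW.
set C := \sum_(i < N) _; set S := \sum_(i < N) _ => C1.
have hs : chord g (a N) (b N) * C <= S.
  apply: IH => i iN ne; have iN1 := ltnW iN.
  have /andP[? ?] := a01 i (leqW iN); have /andP[? ?] := b01 i (leqW iN).
  have /andP[? ?] := a01 N (ltnSn _); have /andP[? ?] := b01 N (ltnSn _).
  by apply: chord_antitone => //; [exact: am|exact: bm].
rewrite (chordE ab) mulrCA.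
apply: (le_trans _ (lerD hs (lexx _))); rewrite -mulrDr.
by apply: ler_wpM2r => //; apply: hq.
Qed.

(** Weak majorization for a concave increasing function: the first inequality
takes the slope [q = 0] above. When [g] is strictly increasing the finitely many
slopes have a positive lower bound, which gives the second one. *)
Lemma majorization (N : nat) (rho a b : nat -> R) :
    (forall i, (i < N)%N -> 0 <= rho i) ->
    (forall i, (i < N)%N -> 0 < a i <= 1) ->
    (forall i, (i < N)%N -> 0 < b i <= 1) ->
    (forall i j, (i <= j)%N -> (j < N)%N -> a i <= a j) ->
    (forall i j, (i <= j)%N -> (j < N)%N -> b i <= b j) ->
    (forall l, (l <= N)%N -> 0 <= \sum_(i < l) rho i * (a i - b i)) ->
  \sum_(i < N) rho i * g (b i) <= \sum_(i < N) rho i * g (a i) /\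
  ((forall p q, 0 < p -> p < q -> q <= 1 -> g p < g q) ->
   0 < \sum_(i < N) rho i * (a i - b i) ->
   \sum_(i < N) rho i * g (b i) < \sum_(i < N) rho i * g (a i)).
Proof.
move=> r0 a01 b01 am bm C0.
have M := majorization_slope r0 a01 b01 am bm C0.
have E : \sum_(i < N) rho i * (g (a i) - g (b i)) =
   \sum_(i < N) rho i * g (a i) - \sum_(i < N) rho i * g (b i).
  by rewrite -sumrB; apply: eq_bigr => i _; rewrite mulrBr.
split.
  rewrite -subr_ge0 -E; apply: le_trans (M 0 _); first by rewrite mul0r.
  move=> i iN _; have /andP[? ?] := a01 i iN; have /andP[? ?] := b01 i iN.
  exact: chord_ge0.
move=> sg C1; rewrite -subr_gt0 -E.
have pc (i : nat) : (i < N)%N -> a i != b i -> 0 < chord g (a i) (b i).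
  move=> iN; have /andP[? ?] := a01 i iN; have /andP[? ?] := b01 i iN.
  rewrite neq_lt => /orP[ab|ab]; rewrite /chord.
    by rewrite nmulr_rgt0 ?invr_lt0 subr_lt0// sg.
  by rewrite divr_gt0// subr_gt0// sg.
have [q q0 hq] : exists2 q, 0 < q &
    forall i, (i < N)%N -> a i != b i -> q <= chord g (a i) (b i).
  clear -pc; elim: N pc => [|N IH] pc; first by exists 1.
  case: IH => [i iN|q q0 hq]; first by apply: pc; exact: leqW.
  have [ab|ab] := eqVneq (a N) (b N).
    exists q => // i; rewrite ltnS leq_eqVlt => /predU1P[->|]; last exact: hq.
    by rewrite ab eqxx.
  exists (Num.min q (chord g (a N) (b N))).
    by rewrite lt_min q0 pc.
  move=> i; rewrite ltnS leq_eqVlt => /predU1P[->|iN ne]; rewrite ge_min.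
    by rewrite lexx orbT.
  by rewrite hq.
by apply: lt_le_trans (M q hq); rewrite mulr_gt0.
Qed.

(** On [[a / 2, 1]] the chords are at most as steep as the one between [a / 4]
and [a / 2], so [g] is Lipschitz there, up to the endpoint 1. *)
Lemma half_kernel_continuous a e : 0 < a -> a <= 1 -> 0 < e ->
  exists2 d, 0 < d & forall b, 0 < b -> b <= 1 -> `|b - a| < d ->
    `|g b - g a| < e.
Proof.
move=> a0 a1 e0; have [_ mo _] := hg.
set L := chord g (a / 2) (a / 4).
have L0 : 0 <= L by apply: chord_ge0; lra.
have Lp p q : a / 2 <= p -> p <= q -> q <= 1 -> 0 <= g q - g p <= L * (q - p).
  move=> ap pq q1; rewrite subr_ge0 mo//=; last lra.
  move: pq; rewrite le_eqVlt => /predU1P[->|pq]; first by rewrite !subrr mulr0.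
  rewrite chordE; last lra.
  by apply: ler_wpM2r; [lra|apply: chord_antitone; lra].
exists (Num.min (a / 2) (e / (L + 1))).
  by rewrite lt_min !divr_gt0//; lra.
move=> b b0 b1; rewrite lt_min => /andP[ab].
rewrite ltr_pdivlMr; last lra.
move: ab; rewrite ltr_norml => /andP[ab1 ab2].
have [ab|/ltW ab] := leP a b.
  have /andP[h1 h2] : 0 <= g b - g a <= L * (b - a) by apply: Lp; lra.
  rewrite !ger0_norm//; last lra.
  move=> h; apply: le_lt_trans h2 (le_lt_trans _ h); nra.
have /andP[h1 h2] : 0 <= g a - g b <= L * (a - b) by apply: Lp; lra.
rewrite distrC (distrC (g b)) !ger0_norm//; last lra.
move=> h; apply: le_lt_trans h2 (le_lt_trans _ h); nra.
Qed.

End half_kernels.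
(** * The two halves of a singular monotone kernel *)

Section kernel_extension.
Context {R : realType}.

Lemma cvg_sides (T : topologicalType) (f : R -> T) (a : R) (l : T) :
  f x @[x --> a^'+] --> l -> f x @[x --> a^'-] --> l -> f x @[x --> a^'] --> l.
Proof.
move=> fr fl U Ul; have := fr _ Ul; have := fl _ Ul.
rewrite /nbhs /= /at_left /at_right /dnbhs /within /=.
apply: filterS2 => x xl xr xa.
by move: xa; rewrite neq_lt => /orP[]; [exact: xl|exact: xr].
Qed.

Definition concave_chord (D : set R) (h : R -> R) :=
  forall p q s, D p -> D s -> p < q -> q < s ->
    (h s - h q) * (q - p) <= (h q - h p) * (s - q).

Lemma concave_onP (D : set R) (h : R -> R) :
  concave_on D h -> concave_chord D h.
Proof.
move=> ch p q s Dp Ds pq qs.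
have t0 : 0 <= (q - p) / (s - p) by rewrite divr_ge0; lra.
have t1 : (q - p) / (s - p) <= 1 by rewrite ler_pdivrMr; lra.
pose t := Itv01 t0 t1.
have : - h (t%:inum * s + (1 - t%:inum) * p) <=
  t%:inum * - h s + (1 - t%:inum) * - h p := ch t s p (mem_set Ds) (mem_set Dp).
rewrite /=.
have -> : (q - p) / (s - p) * s + (1 - (q - p) / (s - p)) * p = q.
  by field; lra.
have -> : (q - p) / (s - p) * - h s + (1 - (q - p) / (s - p)) * - h p =
   - (((q - p) * h s + (s - q) * h p) / (s - p)).
  by field; lra.
rewrite lerN2 ler_pdivrMr; last lra.
move=> h1; lra.
Qed.

(** An increasing concave function on ]0, 1[ lies below its chords extended to
the right, hence is bounded above and has a finite limit at 1; monotonicity and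
the chord inequality pass to that limit. *)
Lemma concave_left_limit (h : R -> R) :
    concave_chord `]0, 1[%classic h ->
    (forall p q, 0 < p -> p <= q -> q < 1 -> h p <= h q) ->
  exists2 l, h x @[x --> 1^'-] --> l &
    forall q, 0 < q -> q < 1 -> h q <= l /\
      forall p, 0 < p -> p < q -> (l - h q) * (q - p) <= (h q - h p) * (1 - q).
Proof.
move=> ch mo.
have cc p q s : 0 < p -> p < q -> q < s -> s < 1 ->
    h s <= h q + (h q - h p) / (q - p) * (1 - q).
  move=> p0 pq qs s1.
  have := ch p q s; rewrite /= !in_itv/= => /(_ _ _ pq qs) => chs.
  have {}chs : (h s - h q) * (q - p) <= (h q - h p) * (s - q).
    by apply: chs; apply/andP; split=> //; lra.
  rewrite -lerBlDl mulrAC ler_pdivlMr; last lra.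
  have := mo p q p0 (ltW pq) (lt_trans qs s1); nra.
have cv : cvg (h x @[x --> 1^'-]).
  apply: nondecreasing_at_left_is_cvgr.
  - near=> x => y z; rewrite !in_itv/= => /andP[xy y1] /andP[xz z1] yz.
    apply: mo => //; apply: lt_trans xy; near: x.
    by apply: nbhs_left_gt.
  - near=> x; exists (h 2^-1 + (h 2^-1 - h 4^-1) / (2^-1 - 4^-1) * (1 - 2^-1)).
    move=> _ [y /= + <-]; rewrite in_itv/= => /andP[xy y1].
    apply: (cc _ _ _ _ _ _ y1); [lra|lra|].
    by apply: lt_trans xy; near: x; apply: nbhs_left_gt; lra.
exists (lim (h x @[x --> 1^'-])) => // q q0 q1; split.
  apply: limr_ge => //; near=> x; apply: mo => //.
  by apply: ltW; near: x; apply: nbhs_left_gt.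
move=> p p0 pq.
have : lim (h x @[x --> 1^'-]) <= h q + (h q - h p) / (q - p) * (1 - q).
  apply: limr_le => //; by near=> x; apply: cc.
by rewrite -lerBlDl mulrAC ler_pdivlMr//; lra.
Unshelve. all: by end_near. Qed.

Lemma half_kernel_extension (h g : R -> R) (l : R) :
    concave_chord `]0, 1[%classic h ->
    (forall p q, 0 < p -> p <= q -> q < 1 -> h p <= h q) ->
    (h x)%:E @[x --> 0^'+] --> -oo%E ->
    h x @[x --> 1^'-] --> l ->
    (forall q, 0 < q -> q < 1 -> g q = h q) -> g 1 = l ->
  half_kernel g.
Proof.
move=> ch mo h0 hl gh g1.
have [l' hl' Hl] := concave_left_limit ch mo.
have {hl' hl} ll : l' = l by apply: cvg_unique hl' hl.
rewrite {}ll {l'} in Hl; split.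
- move=> p q s p0 pq qs; rewrite le_eqVlt => /predU1P[s1|s1].
    rewrite {}s1 in qs *; rewrite g1 !gh; [|lra..].
    by have [_ ->] := Hl q (lt_trans p0 pq) ltac:(lra).
  rewrite !gh; [|lra..]; apply: ch => //=; rewrite in_itv/=; lra.
- move=> p q p0 + q1; rewrite le_eqVlt => /predU1P[->//|pq].
  rewrite gh; [|lra..].
  move: q1; rewrite le_eqVlt => /predU1P[q1|q1].
    by rewrite q1 g1; have [] := Hl p p0 ltac:(lra).
  by rewrite gh; [apply: mo|..]; lra.
- move=> B; have /= := (cvgeNyPlt _).1 h0 B.
  move=> [d /= d0 hd]; exists (Num.min d 1).
    by rewrite lt_min d0/=.
  move=> p p0; rewrite lt_min => /andP[pd p1].
  rewrite gh// -lte_fin; apply: hd => //=.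
  by rewrite sub0r normrN gtr0_norm.
Qed.

Definition kernel_value (K : R -> R) (t : R) : R := fine (kernel_ext K t).

Variable K : R -> R.
Hypothesis K_kernel : is_kernel K.
Hypothesis K_singular : singular K.
Hypothesis K_monotone : monotone_kernel K.

Let KN t := K (- t).

Let chordK : concave_chord `]0, 1[%classic K.
Proof. by case: K_kernel => _ /concave_onP. Qed.

Let chordKN : concave_chord `]0, 1[%classic KN.
Proof.
case: K_kernel => /concave_onP ch _ _ p q s /=; rewrite !in_itv/= => p01 s01 pq qs.
have := ch (- s) (- q) (- p); rewrite /= !in_itv/= /KN => chs.
suff : (K (- p) - K (- q)) * (- q - - s) <= (K (- q) - K (- s)) * (- p - - q) by lra.
by apply: chs; lra.
Qed.

Let monoK p q : 0 < p -> p <= q -> q < 1 -> K p <= K q.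
Proof. by case: K_monotone => _ mo p0 pq q1; apply: mo; rewrite ?in_itv/=; lra. Qed.

Let monoKN p q : 0 < p -> p <= q -> q < 1 -> KN p <= KN q.
Proof. by case: K_monotone => mo _ p0 pq q1; apply: mo; rewrite ?in_itv/=; lra. Qed.

Let cvg_right (h : R -> R) :
    (forall p q, 0 < p -> p <= q -> q < 1 -> h p <= h q) ->
  cvg ((h x)%:E @[x --> 0^'+]).
Proof.
move=> mo; apply: nondecreasing_at_right_is_cvge; near=> x => p q.
rewrite !in_itv/= => /andP[p0 px] /andP[q0 qx] pq; rewrite lee_fin mo//.
by apply: (lt_trans qx); near: x; apply: nbhs_right_lt.
Unshelve. all: by end_near. Qed.

Let K_cvg_singular : (K x)%:E @[x --> 0^'+] --> -oo%E /\
  (KN x)%:E @[x --> 0^'+] --> -oo%E.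
Proof.
have cr := cvg_right monoK; have cl := cvg_right monoKN.
have E : lim ((KN x)%:E @[x --> 0^'+]) = lim ((K x)%:E @[x --> 0^'-]).
  apply/esym/cvg_lim => //; apply/cvg_at_leftNP; rewrite oppr0.
  exact: cl.
have {}cl' : (K x)%:E @[x --> 0^'-] --> lim ((K x)%:E @[x --> 0^'+]).
  case: K_kernel => _ _ ->; rewrite -E.
  by apply/cvg_at_leftNP; rewrite oppr0.
have : lim ((K s)%:E @[s --> 0^']) = lim ((K x)%:E @[x --> 0^'+]).
  by apply/cvg_lim => //; exact: cvg_sides.
move: (K_singular); rewrite /singular /kernel_ext eqxx => -> lK.
split; first by rewrite lK.
case: K_kernel => _ _ e; rewrite lK e -E; exact: cl.
Qed.

(** The only facts about the kernel used below. The monotone one-sided limits at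
0 exist and agree, so the two-sided limit defining [kernel_ext K 0] is also
their common value; the limits at 1 and at -1 are finite. *)
Lemma kernel_ext_singular :
  [/\ half_kernel (kernel_value K), half_kernel (fun t => kernel_value K (- t)),
      kernel_ext K 0 = -oo%E,
      forall t, 0 < t -> t <= 1 -> kernel_ext K t = (kernel_value K t)%:E &
      forall t, 0 < t -> t <= 1 -> kernel_ext K (- t) = (kernel_value K (- t))%:E].
Proof.
have [s1 s2] := K_cvg_singular.
have [l hl _] := concave_left_limit chordK monoK.
have [l' hl' _] := concave_left_limit chordKN monoKN.
have E t : 0 < t -> t < 1 -> kernel_ext K t = (K t)%:E.
  by move=> t0 t1; rewrite /kernel_ext !ifF//; apply/eqP; lra.
have EN t : 0 < t -> t < 1 -> kernel_ext K (- t) = (KN t)%:E.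
  by move=> t0 t1; rewrite /kernel_ext !ifF//; apply/eqP; lra.
have E1 : kernel_ext K 1 = l%:E.
  have n1 : (1 == -1 :> R) = false by apply/eqP; lra.
  rewrite /kernel_ext oner_eq0 n1 eqxx.
  apply/cvg_lim => //; apply: cvg_EFin; [exact: nearW|exact: hl].
have EN1 : kernel_ext K (- 1) = l'%:E.
  rewrite /kernel_ext oppr_eq0 oner_eq0 eqxx.
  apply/cvg_lim => //; apply/cvg_at_rightNP; rewrite opprK.
  apply: cvg_EFin; [exact: nearW|exact: hl'].
split.
- apply: (half_kernel_extension chordK monoK s1 hl) => [q q0 q1|].
    by rewrite /kernel_value E.
  by rewrite /kernel_value E1.
- apply: (half_kernel_extension chordKN monoKN s2 hl') => [q q0 q1|].
    by rewrite /kernel_value EN.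
  by rewrite /kernel_value EN1.
- exact: K_singular.
- move=> t t0; rewrite le_eqVlt => /predU1P[->|t1].
    by rewrite /kernel_value E1.
  by rewrite /kernel_value E.
- move=> t t0; rewrite le_eqVlt => /predU1P[->|t1].
    by rewrite /kernel_value EN1.
  by rewrite /kernel_value EN.
Qed.

End kernel_extension.
(** * Partial sums, semicontinuity along a filter, nodes *)

Section partial_sums.
Context {R : realType}.

Lemma sum_reversed (G : nat -> R) (m l : nat) : (l <= m)%N ->
  \sum_(i < l) G (m - i.+1)%N = \sum_(i < m) G i - \sum_(i < m - l) G i.
Proof.
elim: l => [_|l IH lm]; first by rewrite big_ord0 subn0 subrr.
rewrite big_ord_recr /= IH; last exact: ltnW.
have -> : (m - l = (m - l.+1).+1)%N by lia.
by rewrite big_ord_recr /=; ring.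
Qed.

Lemma sum_shifted (G : nat -> R) (m l : nat) :
  \sum_(i < l) G (m + i)%N = \sum_(i < m + l) G i - \sum_(i < m) G i.
Proof.
elim: l => [|l IH]; first by rewrite big_ord0 addn0 subrr.
by rewrite big_ord_recr /= IH addnS big_ord_recr /=; ring.
Qed.

End partial_sums.

Section upper_semicontinuity.
Context {R : realType}.
Local Open Scope ereal_scope.

Lemma ereal_between (a b : \bar R) : a < b -> exists c : R, a < c%:E /\ c%:E < b.
Proof.
case: a b => [a| |] [b| |] //= ab.
- by exists ((a + b) / 2)%R; rewrite !lte_fin; rewrite lte_fin in ab; split; lra.
- by exists (a + 1)%R; rewrite lte_fin ltry; split=> //; lra.
- by exists (b - 1)%R; rewrite lte_fin ltNyr; split=> //; lra.
- by exists 0%R; rewrite ltNyr ltry.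
Qed.

Lemma ereal_add_lt_split (a b : \bar R) (c : R) :
    a < +oo -> b < +oo -> a + b < c%:E ->
  exists d : R, a < d%:E /\ b < (c - d)%:E.
Proof.
move=> a_lt; case: b => [b| |] //= b_lt ab.
  rewrite -lteBrDr// in ab; have [d [ad dc]] := ereal_between ab.
  exists d; split=> //; rewrite -EFinB lte_fin in dc; rewrite lte_fin; lra.
by have [d [ad _]] := ereal_between a_lt; exists d; rewrite ltNyr.
Qed.

(** Upper semicontinuity of [f] at a point of value [a], for an arbitrary filter
[G]: the filters needed are neighbourhoods of a pair (argument, node system)
restricted to the domain where [f] is meaningful. *)
Definition usc_along {T : Type} (G : set_system T) (f : T -> \bar R) (a : \bar R) :=
  forall c : R, a < c%:E -> \forall x \near G, f x < c%:E.

Context {T : Type} (G : set_system T) {FG : Filter G}.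

Lemma usc_alongD f g a b : a < +oo -> b < +oo ->
  usc_along G f a -> usc_along G g b -> usc_along G (fun x => f x + g x) (a + b).
Proof.
move=> a_lt b_lt fa gb c /(ereal_add_lt_split a_lt b_lt)[d [/fa hf /gb hg]].
apply: filterS2 hf hg => x fx gx.
have -> : c = (d + (c - d))%R by ring.
by rewrite EFinD lteD.
Qed.

Lemma usc_alongZ f a (s : R) : (0 < s)%R ->
  usc_along G f a -> usc_along G (fun x => s%:E * f x) (s%:E * a).
Proof.
move=> s0 fa c; rewrite -lte_pdivlMl// -EFinM => /fa.
by apply: filterS => x; rewrite EFinM lte_pdivlMl.
Qed.

Lemma usc_along_sum (I : Type) (s : seq I) (f : I -> T -> \bar R) (a : I -> \bar R) :
    (forall i, a i < +oo) -> (forall i, usc_along G (f i) (a i)) ->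
  usc_along G (fun x => \sum_(i <- s) f i x) (\sum_(i <- s) a i).
Proof.
move=> a_lt fa; elim: s => [|i s IH].
  rewrite big_nil => c c0; apply: nearW => x; by rewrite big_nil.
rewrite big_cons => c /(usc_alongD (a_lt i) _ (fa i) IH) h.
have : \forall x \near G, f i x + \sum_(j <- s) f j x < c%:E.
  apply: h; elim: s {IH} => [|j s IH]; first by rewrite big_nil ltry.
  by rewrite big_cons lte_add_pinfty.
by apply: filterS => x; rewrite big_cons.
Qed.

End upper_semicontinuity.

Section nodes.
Context {R : realType} {n : nat}.
Implicit Types x y : 'rV[R]_n.

Lemma node_coord y (i : 'I_n) : node y i.+1 = y 0 i.
Proof. by rewrite /node valK. Qed.

Lemma neq_node y t i : (forall j, t != y 0 j) -> (i < n)%N -> t != node y i.+1.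
Proof. by move=> ty iN; have := ty (Ordinal iN); rewrite -node_coord. Qed.

Lemma node_last y : node y n.+1 = 1.
Proof. by rewrite /node insubN// ltnn. Qed.

Lemma node_bounds y i : closed_simplex y -> 0 <= node y i <= 1.
Proof.
case=> y01 _; case: i => [|i] /=; first by rewrite lexx ler01.
case: insubP => [j _ _|_]; first exact: y01.
by rewrite ler01 lexx.
Qed.

Lemma node_le y i j : closed_simplex y -> (i <= j)%N -> node y i <= node y j.
Proof.
move=> cy; case: i => [|i]; first by case/andP: (node_bounds j cy).
case: j => // j; rewrite ltnS => ij.
have [jn|nj] := ltnP j n; last first.
  by rewrite {2}/node insubN -?leqNgt//; case/andP: (node_bounds i.+1 cy).
have iN := leq_ltn_trans ij jn.
rewrite (node_coord y (Ordinal iN)) (node_coord y (Ordinal jn)).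
by case: cy => _; apply.
Qed.

Lemma open_simplex_closed y : open_simplex y -> closed_simplex y.
Proof.
case=> y01 yl; split=> [i|i j]; first by case/andP: (y01 i) => /ltW-> /ltW->.
by rewrite leq_eqVlt => /predU1P[/val_inj->//|/yl/ltW].
Qed.

End nodes.
Arguments node : simpl never.

(** * Intertwining *)

Section sum_of_translates.
Context {R : realType} {n : nat}.
Variables (r : 'I_n -> R) (K : R -> R) (J : R -> \bar R).
Hypothesis r_gt0 : forall j, 0 < r j.

Let k := kernel_value K.
Hypothesis kR : half_kernel k.
Hypothesis kL : half_kernel (fun t => k (- t)).
Hypothesis k0 : kernel_ext K 0 = -oo%E.
Hypothesis kpos : forall t, 0 < t -> t <= 1 -> kernel_ext K t = (k t)%:E.
Hypothesis kneg : forall t, 0 < t -> t <= 1 -> kernel_ext K (- t) = (k (- t))%:E.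
Implicit Types x y : 'rV[R]_n.

Lemma kernel_extE t : -1 <= t -> t <= 1 -> t != 0 -> kernel_ext K t = (k t)%:E.
Proof.
move=> t1 t2; rewrite neq_lt => /orP[t0|t0]; last exact: kpos.
by rewrite -[t]opprK kneg//; lra.
Qed.

(** The kernel part of [sum_translates] as a real number; it has this meaning only
away from the nodes, where no term is -oo. *)
Definition real_translates (y : 'rV[R]_n) (t : R) : R :=
  \sum_(j < n) r j * k (t - y 0 j).

Lemma sum_translatesE y t : closed_simplex y -> 0 <= t -> t <= 1 ->
    (forall j, t != y 0 j) ->
  sum_translates r K J y t = (J t + (real_translates y t)%:E)%E.
Proof.
move=> [y01 _] t0 t1 ty; rewrite /sum_translates /real_translates -sumEFin.
congr (_ + _)%E; apply: eq_bigr => j _; rewrite kernel_extE ?EFinM//.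
- by have := y01 j; lra.
- by have := y01 j; lra.
- by rewrite subr_eq0.
Qed.

Lemma sum_translates_node y j : sum_translates r K J y (y 0 j) = -oo%E.
Proof.
rewrite /sum_translates (_ : (\sum_(j < n) _)%E = -oo%E) ?addeNy//.
by apply/esum_eqNyP; exists j; split=> //; rewrite subrr k0 gt0_muleNy ?lte_fin.
Qed.

(** The weights indexed by [nat], so that sums over the nodes can be cut at an
interval and reversed. *)
Definition weight (i : nat) : R := if insub i is Some j then r j else 0.

Lemma weight_ge0 i : 0 <= weight i.
Proof. by rewrite /weight; case: insub => // j; exact: ltW. Qed.

Lemma weight_gt0 i : (i < n)%N -> 0 < weight i.
Proof. by move=> iN; rewrite /weight insubT. Qed.

Lemma real_translatesE y t :
  real_translates y t = \sum_(i < n) weight i * k (t - node y i.+1).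
Proof.
by apply: eq_bigr => j _; rewrite node_coord /weight valK.
Qed.

(** The sum cut at the interval of index [m], each part being indexed outwards
from that interval, as in [majorization]. *)
Lemma real_translates_split y t m : (m <= n)%N ->
  real_translates y t =
    \sum_(i < m) weight (m - i.+1) * k (t - node y (m - i)) +
    \sum_(i < n - m) weight (m + i) * k (- (node y (m + i).+1 - t)).
Proof.
move=> mn; rewrite real_translatesE.
pose G i := weight i * k (t - node y i.+1).
rewrite [X in X + _](_ : _ = \sum_(i < m) G (m - i.+1)%N); last first.
  apply: eq_bigr => i _; rewrite /G; congr (_ * k (t - node y _)).
  by have := ltn_ord i; lia.
rewrite [X in _ + X](_ : _ = \sum_(i < n - m) G (m + i)%N); last first.
  by apply: eq_bigr => i _; rewrite /G opprB.
rewrite sum_reversed// sum_shifted subnKC// subnn big_ord0; rewrite /G.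
ring.
Qed.

(** The weighted displacement of the first [l] nodes when [x] is moved to [y].
The interval at which it is largest is the one towards which, in the weighted
sense, nodes move from both sides. *)
Definition drift x y (l : nat) : R :=
  \sum_(i < l) weight i * (node y i.+1 - node x i.+1).

(** The neighbouring values of the drift are not larger than the maximal one, so
the node at the left of the interval of index [m] moves right and the one at its
right moves left. *)
Lemma drift_argmax_itv x y m : (m <= n)%N ->
    (forall l, (l <= n)%N -> drift x y l <= drift x y m) ->
  node x m <= node y m /\ node y m.+1 <= node x m.+1.
Proof.
move=> mn Hm; split.
  case: m mn Hm => // m mn /(_ m (ltnW mn)).
  by rewrite /drift big_ord_recr /= lerDl pmulr_rge0 ?subr_ge0// weight_gt0.
have [mn'|nm] := ltnP m n; last first.
  have -> : m = n by lia.
  by rewrite !node_last.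
have := Hm m.+1 mn'.
by rewrite /drift big_ord_recr /= gerDl pmulr_rle0 ?subr_le0// weight_gt0.
Qed.

(** On each side of [t] the partial sums of the displacements towards [t] are
differences [drift x y m - drift x y l], nonnegative by the choice of [m]. Hence
both parts of the sum can only decrease, by [majorization] for the corresponding
half of the kernel. Since [drift x y 0 = 0], a positive maximum means that the
total displacement of the left part is positive, so that this part decreases
strictly for a strictly increasing kernel. *)
Lemma real_translates_dominated x y m t :
    closed_simplex x -> closed_simplex y -> (m <= n)%N ->
    (forall l, (l <= n)%N -> drift x y l <= drift x y m) ->
    node y m <= t -> t <= node y m.+1 ->
    (forall j, t != y 0 j) -> (forall j, t != x 0 j) ->
  real_translates y t <= real_translates x t /\
  ((forall p q, 0 < p -> p < q -> q <= 1 -> k p < k q) -> 0 < drift x y m ->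
   real_translates y t < real_translates x t).
Proof.
move=> cx cy mn Hm ymt tym ty tx.
have [xy yx] := drift_argmax_itv mn Hm.
have xmt := le_trans xy ymt; have txm := le_trans tym yx.
have left (z : 'rV[R]_n) i : closed_simplex z -> node z m <= t -> (forall j, t != z 0 j) ->
    (i < m)%N -> 0 < t - node z (m - i) <= 1.
  move=> cz zmt tz im; rewrite subr_gt0 lt_neqAle.
  have e : (m - i = (m - i.+1).+1)%N by lia.
  rewrite e eq_sym neq_node//=; last by lia.
  have /andP[? _] := node_bounds (m - i.+1).+1 cz.
  have /andP[? ?] := node_bounds m.+1 cy.
  by rewrite (le_trans (node_le cz _) zmt) /=; [lra|lia].
have right (z : 'rV[R]_n) i : closed_simplex z -> t <= node z m.+1 -> (forall j, t != z 0 j) ->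
    (i < n - m)%N -> 0 < node z (m + i).+1 - t <= 1.
  move=> cz tzm tz im; rewrite subr_gt0 lt_neqAle neq_node//=; last by lia.
  have /andP[_ ?] := node_bounds (m + i).+1 cz.
  have /andP[? ?] := node_bounds m cy.
  by rewrite (le_trans tzm (node_le cz _)) /=; [lra|lia].
have [ML MLs] : let Sl (z : 'rV[R]_n) := \sum_(i < m) weight (m - i.+1) * k (t - node z (m - i)) in
   Sl y <= Sl x /\
   ((forall p q, 0 < p -> p < q -> q <= 1 -> k p < k q) -> 0 < drift x y m ->
   Sl y < Sl x).
  have E l : (l <= m)%N -> \sum_(i < l) weight (m - i.+1) *
      (t - node x (m - i) - (t - node y (m - i))) = drift x y m - drift x y (m - l).
    move=> lm; rewrite /drift.
    rewrite -(sum_reversed (fun i => weight i * (node y i.+1 - node x i.+1)))//.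
    apply: eq_bigr => i _.
    have -> : (m - i = (m - i.+1).+1)%N by have := ltn_ord i; lia.
    by congr (_ * _); ring.
  have := @majorization _ k kR m (fun i => weight (m - i.+1))
    (fun i => t - node x (m - i)) (fun i => t - node y (m - i)).
  rewrite E// subnn [drift x y 0]/drift big_ord0 subr0; apply.
  - by move=> i _; exact: weight_ge0.
  - by move=> i im; exact: left.
  - by move=> i im; exact: left.
  - by move=> i j ij jm; rewrite lerD2l lerN2 node_le//; lia.
  - by move=> i j ij jm; rewrite lerD2l lerN2 node_le//; lia.
  - by move=> l lm; rewrite E// subr_ge0 Hm//; lia.
have MR : let Sr (z : 'rV[R]_n) := \sum_(i < n - m) weight (m + i) *
    k (- (node z (m + i).+1 - t)) in Sr y <= Sr x.
  have := @majorization _ _ kL (n - m) (fun i => weight (m + i))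
    (fun i => node x (m + i).+1 - t) (fun i => node y (m + i).+1 - t).
  case=> [i _|i im|i im|i j ij jm|i j ij jm|l lm|le_R _ //].
  - exact: weight_ge0.
  - exact: right.
  - exact: right.
  - by rewrite lerB// node_le//; lia.
  - by rewrite lerB// node_le//; lia.
  have -> : \sum_(i < l) weight (m + i) *
      (node x (m + i).+1 - t - (node y (m + i).+1 - t)) =
      - \sum_(i < l) weight (m + i) * (node y (m + i).+1 - node x (m + i).+1).
    by rewrite -sumrN; apply: eq_bigr => i _; ring.
  rewrite (sum_shifted (fun i => weight i * (node y i.+1 - node x i.+1))).
  by rewrite oppr_ge0 subr_le0; apply: Hm; lia.
rewrite !(real_translates_split _ _ mn); split; first exact: lerD.
by move=> sk dp; apply: ltr_leD => //; exact: MLs.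
Qed.

(** A point of the interval of [y] that is not a node of [y] is not a node of [x]
either, because the interval of [x] of the same index is larger. *)
Lemma translates_dominated x y m t :
    closed_simplex x -> closed_simplex y -> (m <= n)%N ->
    (forall l, (l <= n)%N -> drift x y l <= drift x y m) ->
    node y m <= t -> t <= node y m.+1 ->
  (sum_translates r K J y t <= sum_translates r K J x t)%E /\
  ((forall p q, 0 < p -> p < q -> q <= 1 -> k p < k q) -> 0 < drift x y m ->
   sum_translates r K J y t \is a fin_num ->
   (sum_translates r K J y t < sum_translates r K J x t)%E).
Proof.
move=> cx cy mn Hm ymt tym.
have [[j ->]|ty] := pselect (exists j, t = y 0 j).
  by rewrite sum_translates_node leNye.
have {}ty j : t != y 0 j by apply/eqP => e; apply: ty; exists j.
have [xy yx] := drift_argmax_itv mn Hm.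
have tx j : t != x 0 j.
  apply/eqP => e; rewrite -node_coord in e.
  have jn := ltn_ord j; have [jm|mj] := ltnP j m.
    case: m mn Hm ymt tym xy yx jm => // m mn _ ymt _ xy _ jm.
    have h := node_le cx jm; have /eqP := neq_node ty mn; apply.
    by apply/eqP; rewrite eq_le ymt andbT e (le_trans h).
  have mn' : (m < n)%N by exact: leq_ltn_trans mj jn.
  have /eqP := neq_node ty mn'; apply; apply/eqP; rewrite eq_le tym /=.
  by rewrite (le_trans yx)// e node_le.
have t0 : 0 <= t by have := node_bounds m cy; lra.
have t1 : t <= 1 by have := node_bounds m.+1 cy; lra.
have [le_xy lt_xy] := real_translates_dominated cx cy mn Hm ymt tym ty tx.
rewrite !sum_translatesE//; split; first by rewrite leeD2l ?lee_fin.
move=> sk dp; rewrite fin_numD => /andP[Jt _].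
by rewrite lteD2lE// lte_fin lt_xy.
Qed.

(** * Continuity of the interval suprema *)

Hypothesis J_field : is_field_function n J.
Hypothesis J_usc : upper_semicontinuous_on `[0, 1] J.

Lemma J_lt t : 0 <= t -> t <= 1 -> (J t < +oo)%E.
Proof.
case: J_field => [[B JB] _] t0 t1; apply: le_lt_trans (ltry B).
by apply: JB; rewrite in_itv/= t0.
Qed.

Lemma kernel_ext_lt_pinfty u : -1 <= u -> u <= 1 -> (kernel_ext K u < +oo)%E.
Proof.
move=> u1 u2; have [->|u0] := eqVneq u 0; first by rewrite k0.
by rewrite kernel_extE// ltry.
Qed.

Lemma kernel_value_continuous (u e : R) : -1 <= u -> u <= 1 -> u != 0 -> 0 < e ->
  \forall v \near u, -1 <= v -> v <= 1 -> v != 0 /\ `|k v - k u| < e.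
Proof.
move=> u1 u2; rewrite neq_lt => /orP[u0|u0] e0.
  have [d d0 hd] := @half_kernel_continuous _ _ kL (- u) e ltac:(lra) ltac:(lra) e0.
  exists (Num.min d (- u)) => /=; first by rewrite lt_min d0 oppr_gt0.
  move=> v /=; rewrite lt_min => /andP[h1 h2] v1 v2.
  have v0 : v < 0 by move: h2; rewrite ltr_norml; lra.
  split; first by rewrite lt_eqF.
  have := hd (- v); rewrite !opprK; apply; [lra|lra|].
  by rewrite addrC.
have [d d0 hd] := half_kernel_continuous kR u0 u2 e0.
exists (Num.min d u) => /=; first by rewrite lt_min d0 u0.
move=> v /=; rewrite lt_min => /andP[h1 h2] v1 v2.
have v0 : 0 < v by move: h2; rewrite ltr_norml; lra.
split; first by rewrite gt_eqF.
by apply: hd => //; rewrite distrC.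
Qed.

Lemma kernel_ext_usc (u : R) : -1 <= u -> u <= 1 ->
  usc_along (within [set v | -1 <= v <= 1] (nbhs u)) (kernel_ext K) (kernel_ext K u).
Proof.
move=> u1 u2 c; have [->|u0] := eqVneq u 0.
  move=> _; have [_ _ /(_ c)[d d0 hd]] := kR; have [_ _ /(_ c)[d' d'0 hd']] := kL.
  exists (Num.min d d') => /=; first by rewrite lt_min d0 d'0.
  move=> v /=; rewrite sub0r normrN lt_min => /andP[vd vd'] /andP[v1 v2].
  have [->|] := eqVneq v 0; first by rewrite k0 ltNyr.
  rewrite neq_lt => /orP[v0|v0].
    rewrite -[v]opprK kneg ?lte_fin; [|lra..].
    by apply: hd'; [lra|rewrite -(ltr0_norm v0)].
  by rewrite kpos// lte_fin hd// -(gtr0_norm v0).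
rewrite kernel_extE// lte_fin => uc.
have := @kernel_value_continuous u (c - k u) u1 u2 u0 ltac:(lra).
apply: filterS => v hv /andP[v1 v2]; have [v0] := hv v1 v2.
by rewrite kernel_extE// lte_fin ltr_norml; lra.
Qed.

(** Joint semicontinuity in the argument and the nodes. At a node the sum is -oo
and the singularity of the kernel keeps it small nearby. *)
Lemma sum_translates_usc (s : R) (w : 'rV[R]_n) :
    0 <= s -> s <= 1 -> closed_simplex w ->
  usc_along
    (within [set p : R * 'rV[R]_n | 0 <= p.1 <= 1 /\ closed_simplex p.2]
       (nbhs (s, w)))
    (fun p => sum_translates r K J p.2 p.1) (sum_translates r K J w s).
Proof.
move=> s0 s1 cw; have [w01 _] := cw.
have kw (j : 'I_n) : (kernel_ext K (s - w 0 j)%R < +oo)%E.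
  by have := w01 j => ?; apply: kernel_ext_lt_pinfty; lra.
have rkw (j : 'I_n) : ((r j)%:E * kernel_ext K (s - w 0 j)%R < +oo)%E.
  by rewrite lte_mul_pinfty ?lee_fin ?ltW.
apply: usc_alongD; first exact: J_lt.
- by apply: (big_ind (fun x : \bar R => (x < +oo)%E)) => // x y; exact: lte_add_pinfty.
- move=> c Jc; have := @J_usc s _ c Jc; rewrite /= in_itv/= s0 s1 => /(_ isT) h.
  have : \forall p \near (s, w), `[0, 1]%classic p.1 -> (J p.1 < c%:E)%E.
    exact: cvg_fst h.
  by apply: filterS => p hp [p01 _]; apply: hp; rewrite /= in_itv.
apply: usc_along_sum => // j; apply: usc_alongZ => // c.
have ws := w01 j.
move=> /(@kernel_ext_usc (s - w 0 j) ltac:(lra) ltac:(lra)) h.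
have cv : (fun p : R * 'rV[R]_n => p.1 - p.2 0 j) @ nbhs (s, w) --> s - w 0 j.
  apply: cvgB; first exact: cvg_fst.
  apply: (@cvg_comp _ _ _ (fun p : R * 'rV[R]_n => p.2) (fun z => z 0 j) _ (nbhs w)).
    exact: cvg_snd.
  exact: coord_continuous.
have {}h : nbhs (s, w) [set p : R * 'rV[R]_n | -1 <= p.1 - p.2 0 j <= 1 ->
  (kernel_ext K (p.1 - p.2 0 j)%R < c%:E)%E] := cv _ h.
apply: filterS h => p hp [/andP[p0 p1] [p01 _]].
apply: hp; have := p01 j; lra.
Qed.

(** Lower semicontinuity is needed at a fixed argument only, because suprema
inherit it. *)
Lemma real_translates_lsc (t : R) (w : 'rV[R]_n) (e : R) :
    0 <= t -> t <= 1 -> closed_simplex w -> (forall j, t != w 0 j) -> 0 < e ->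
  \forall z \near w, closed_simplex z ->
    (forall j, t != z 0 j) /\ real_translates w t - e < real_translates z t.
Proof.
move=> t0 t1 cw tw e0; have [w01 _] := cw.
pose M := \sum_(j < n) r j + 1.
have M0 : 0 < M by rewrite ltr_pwDr// sumr_ge0// => j _; exact: ltW.
pose P (j : 'I_n) : set 'rV[R]_n := [set z | closed_simplex z ->
    t != z 0 j /\ `|k (t - z 0 j) - k (t - w 0 j)| < e / M].
have H (j : 'I_n) : \forall z \near w, P j z.
  have := w01 j => ?; have tw' : t - w 0 j != 0 by rewrite subr_eq0.
  have := @kernel_value_continuous (t - w 0 j) (e / M) ltac:(lra) ltac:(lra)
    tw' (divr_gt0 e0 M0) => h.
  have cv : (fun z : 'rV[R]_n => t - z 0 j) @ nbhs w --> t - w 0 j.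
    by apply: cvgB; [exact: cvg_cst|exact: coord_continuous].
  have {}h : nbhs w [set z : 'rV[R]_n | -1 <= t - z 0 j -> t - z 0 j <= 1 ->
    t - z 0 j != 0 /\ `|k (t - z 0 j) - k (t - w 0 j)| < e / M] := cv _ h.
  apply: filterS h => z hz [z01 _].
  have := z01 j => ?; rewrite -subr_eq0; apply: hz; lra.
have {}H := @filter_forall _ _ P _ (nbhs_filter w) H.
apply: filterS H => z Hz cz; split=> [j|]; first by have [] := Hz j cz.
rewrite ltrBlDr -ltrBlDl /real_translates -sumrB.
apply: (@le_lt_trans _ _ (\sum_(j < n) r j * (e / M))).
  apply: ler_sum => j _; rewrite -mulrBr ler_wpM2l ?ltW//.
  have [_] := Hz j cz; rewrite distrC; exact/le_lt_trans/ler_norm.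
rewrite -mulr_suml mulrCA gtr_pMr// ltr_pdivrMr// mul1r /M; lra.
Qed.

Lemma node_continuous i : continuous (fun y : 'rV[R]_n => node y i).
Proof.
rewrite /node; case: i => [|i]; first exact: cst_continuous.
by case: (insub i) => [j|]; [exact: coord_continuous|exact: cst_continuous].
Qed.

(** [local_sup] indexed by [nat]. *)
Definition interval_sup (y : 'rV[R]_n) (j : nat) : \bar R :=
  ereal_sup [set sum_translates r K J y t | t in `[node y j, node y j.+1]%classic].

Lemma interval_sup_ub y j t : node y j <= t -> t <= node y j.+1 ->
  (sum_translates r K J y t <= interval_sup y j)%E.
Proof.
move=> jt tj; apply: ereal_sup_ubound; exists t => //=.
by rewrite in_itv/= jt.
Qed.

Lemma interval_sup_le y j a :
    (forall t, node y j <= t -> t <= node y j.+1 -> (sum_translates r K J y t <= a)%E) ->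
  (interval_sup y j <= a)%E.
Proof.
move=> h; apply: ge_ereal_sup => _ [t /= + <-].
by rewrite in_itv/= => /andP[]; exact: h.
Qed.

Lemma interval_sup_gt y j a : (a < interval_sup y j)%E ->
  exists t, [/\ node y j <= t, t <= node y j.+1 & (a < sum_translates r K J y t)%E].
Proof.
move=> /ereal_sup_gt[_ [t /= + <-]]; rewrite in_itv/= => /andP[? ?] ?.
by exists t.
Qed.

Lemma sum_translates_neq_node y t : sum_translates r K J y t != -oo%E ->
  forall j, t != y 0 j.
Proof.
by move=> h j; apply: contraNneq h => ->; rewrite sum_translates_node.
Qed.

(** A point of an interval that is not a node stays in the interval when the
nodes move slightly; the outer ends 0 and 1 do not move. *)
Lemma near_node_interval (w : 'rV[R]_n) i t : (i <= n)%N -> closed_simplex w ->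
    node w i <= t -> t <= node w i.+1 -> (forall j, t != w 0 j) ->
  \forall z \near w, node z i <= t /\ t <= node z i.+1.
Proof.
move=> iN cw it ti tw.
have Hl : \forall z \near w, node z i <= t.
  case: i iN it {ti} => [|i] iN it; first exact: (@filterS _ _ _ setT) filterT.
  have lt : node w i.+1 < t by rewrite lt_neqAle it eq_sym neq_node.
  have := @cvgr_lt _ _ _ (nbhs_filter w) _ _ (@node_continuous i.+1 w) _ lt.
  by apply: filterS => z /ltW.
have Hr : \forall z \near w, t <= node z i.+1.
  have [iN'|ni] := ltnP i n.
    have lt : t < node w i.+1 by rewrite lt_neqAle ti neq_node.
    have := @cvgr_gt _ _ _ (nbhs_filter w) _ _ (@node_continuous i.+1 w) _ lt.
    by apply: filterS => z /ltW.
  have -> : i = n by lia.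
  apply: (@filterS _ _ _ setT) filterT => z _; rewrite node_last.
  by have := node_bounds i.+1 cw; lra.
by apply: filterS2 Hl Hr => z.
Qed.

(** A value above [c] is taken at a point that is not a node, hence still belongs
to the interval and keeps a value above [c] for neighbouring node systems. *)
Lemma interval_sup_lsc (w : 'rV[R]_n) i (c : R) : (i <= n)%N -> closed_simplex w ->
    (c%:E < interval_sup w i)%E ->
  \forall z \near w, closed_simplex z -> (c%:E < interval_sup z i)%E.
Proof.
move=> iN cw /interval_sup_gt[t [it ti ct]].
have tw : forall j, t != w 0 j.
  by apply: sum_translates_neq_node; rewrite gt_eqF// (lt_trans _ ct)// ltNyr.
have t0 : 0 <= t by have := node_bounds i cw; lra.
have t1 : t <= 1 by have := node_bounds i.+1 cw; lra.
rewrite sum_translatesE// in ct.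
have [e e0 he] : exists2 e, 0 < e & forall z : R, real_translates w t - e < z ->
    (c%:E < J t + z%:E)%E.
  have := J_lt t0 t1; case: (J t) ct => [a| |]//=.
  rewrite -EFinD lte_fin => ct _; exists (a + real_translates w t - c); first lra.
  by move=> z; rewrite -EFinD lte_fin; lra.
have := real_translates_lsc t0 t1 cw tw e0.
have := near_node_interval iN cw it ti tw.
apply: filterS2 => z [iz zi] hz cz; have [tz lt] := hz cz.
by apply: lt_le_trans (interval_sup_ub iz zi); rewrite sum_translatesE//; exact: he.
Qed.

(** Every [s] in [[0, 1]] has, together with [w], a neighbourhood on which either
the sum stays below [c], by joint semicontinuity, or the argument lies outside
the interval; compactness of [[0, 1]] makes the neighbourhood of [w] uniform. *)
Lemma interval_sup_usc (w : 'rV[R]_n) i (c : R) : (i <= n)%N -> closed_simplex w ->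
    (interval_sup w i < c%:E)%E ->
  \forall z \near w, closed_simplex z -> (interval_sup z i <= c%:E)%E.
Proof.
move=> iN cw wc.
have /compact_near_coveringP cov := @segment_compact R 0 1.
pose P (z : 'rV[R]_n) (t : R) := 0 <= t <= 1 -> closed_simplex z ->
  node z i <= t -> t <= node z i.+1 -> (sum_translates r K J z t < c%:E)%E.
have : \near w, `[0, 1]%classic `<=` P w.
  apply: (cov _ (nbhs w) P) => s; rewrite /= in_itv/= => /andP[s0 s1].
  suff : nbhs (s, w) [set p : R * 'rV[R]_n | P p.2 p.1] by [].
  have [/andP[is_ si]|] := boolP (node w i <= s <= node w i.+1).
    have h : nbhs (s, w) [set p : R * 'rV[R]_n |
        0 <= p.1 <= 1 /\ closed_simplex p.2 ->
        (sum_translates r K J p.2 p.1 < c%:E)%E] :=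
      sum_translates_usc s0 s1 cw (le_lt_trans (interval_sup_ub is_ si) wc).
    by apply: filterS h => -[t z] /= h t01 cz _ _; exact: h.
  have cn m : (fun p : R * 'rV[R]_n => node p.2 m - p.1) @ nbhs (s, w) --> node w m - s.
    apply: cvgB; last exact: cvg_fst.
    apply: (@cvg_comp _ _ _ (fun p : R * 'rV[R]_n => p.2) (fun z => node z m) _ (nbhs w)).
      exact: cvg_snd.
    exact: node_continuous.
  rewrite negb_and -!ltNge => /orP[lt|lt].
    have := @cvgr_gt _ _ _ (nbhs_filter (s, w)) _ _ (cn i) 0; rewrite subr_gt0 => /(_ lt).
    by apply: filterS => -[t z] /=; rewrite subr_gt0 => h _ _; rewrite leNgt h.
  have := @cvgr_lt _ _ _ (nbhs_filter (s, w)) _ _ (cn i.+1) 0; rewrite subr_lt0 => /(_ lt).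
  by apply: filterS => -[t z] /=; rewrite subr_lt0 => h _ _ _; rewrite leNgt h.
apply: filterS => z hz cz; apply: interval_sup_le => t it ti; apply/ltW.
have t0 : 0 <= t by have := node_bounds i cz; lra.
have t1 : t <= 1 by have := node_bounds i.+1 cz; lra.
by apply: hz => //=; rewrite ?in_itv/= t0.
Qed.

(** Otherwise each point of the interval has a neighbourhood where the sum stays
below some [c < v], and by compactness one [c] serves for the whole interval. *)
Lemma interval_sup_attained y i (v : R) : (i <= n)%N -> closed_simplex y ->
    interval_sup y i = v%:E ->
  exists t, [/\ node y i <= t, t <= node y i.+1 & sum_translates r K J y t = v%:E].
Proof.
move=> iN cy yv; apply: contrapT => nex.
have lt t : node y i <= t -> t <= node y i.+1 -> (sum_translates r K J y t < v%:E)%E.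
  move=> it ti; rewrite lt_neqAle -yv interval_sup_ub// andbT yv.
  by apply: contra_notN nex => /eqP tv; exists t.
have /compact_near_coveringP cov := @segment_compact R (node y i) (node y i.+1).
pose P (c t : R) := 0 <= t <= 1 -> (sum_translates r K J y t < c%:E)%E.
have H : \forall c \near v^'-, `[node y i, node y i.+1]%classic `<=` P c.
  apply: (cov _ v^'- P) => s; rewrite /= in_itv/= => /andP[is_ si].
  have s0 : 0 <= s by have := node_bounds i cy; lra.
  have s1 : s <= 1 by have := node_bounds i.+1 cy; lra.
  have [c [sc]] := ereal_between (lt s is_ si); rewrite lte_fin => cv.
  have [[U V] /= [Us Vy] UV] := sum_translates_usc s0 s1 cy sc.
  exists (U, [set d | c <= d]) => /=.
    by split=> //; exact: nbhs_left_ge.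
  move=> [t d] /= [Ut cd] t01; apply: lt_le_trans (_ : (c%:E <= _)%E) => //.
  by apply: (UV (t, y)) => //; split=> //; exact: nbhs_singleton.
have [c [cv Hc]] : exists c, c < v /\ `[node y i, node y i.+1]%classic `<=` P c.
  near v^'- => c; exists c; split=> //.
  by near: c.
have : (interval_sup y i <= c%:E)%E.
  apply: interval_sup_le => t it ti; apply/ltW/Hc; first by rewrite /= in_itv/= it.
  have := node_bounds i cy; have := node_bounds i.+1 cy; lra.
by rewrite yv lee_fin leNgt cv.
Unshelve. all: by end_near. Qed.
(** * Existence of an equioscillation point *)

Lemma node_agree (w z : 'rV[R]_n) (j : 'I_n) m :
  (forall l, l != j -> z 0 l = w 0 l) -> m != j.+1 -> node z m = node w m.
Proof.
move=> zw; case: m => // m; rewrite eqSS /node => mj.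
by case: insubP => // l _ lm; apply: zw; rewrite -val_eqE /= lm.
Qed.

(** Raising the node [j] to [z] preserves [m_i <= m_(i+1)] when it does not
separate the two intervals. For [s] in the first and [t] in the second interval,
both on the same side of the raised node, concavity makes the increase of the
sum at [t] at least that at [s]. Moreover the first interval can only shrink and
the second one only grow. *)
Lemma off_diagonal (w z : 'rV[R]_n) (j : 'I_n) i :
    closed_simplex w -> closed_simplex z ->
    (forall l, l != j -> z 0 l = w 0 l) -> w 0 j < z 0 j ->
    (i < n)%N -> i != j :> nat ->
    (interval_sup w i <= interval_sup w i.+1)%E ->
  (interval_sup z i <= interval_sup z i.+1)%E.
Proof.
move=> cw cz zw wz iN ij wi; apply: interval_sup_le => s is_ si.
have [->|Fs] := eqVneq (sum_translates r K J z s) -oo%E; first exact: leNye.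
have sz := sum_translates_neq_node Fs.
have agree m : m != j.+1 -> node z m = node w m by exact: node_agree.
have nle m : node w m <= node z m.
  have [->|/agree->//] := eqVneq m j.+1.
  by rewrite !node_coord ltW.
have wj := node_coord w j; have zj := node_coord z j.
have s01 : 0 <= s <= 1.
  by have := node_bounds i cz; have := node_bounds i.+1 cz; lra.
have wj01 : 0 <= w 0 j <= 1 by case: cw.
have zj01 : 0 <= z 0 j <= 1 by case: cz.
have [sw [siw Ht]] : (forall l, s != w 0 l) /\ (node w i <= s <= node w i.+1 /\
    forall t, node w i.+1 <= t -> t <= node w i.+2 -> (forall l, t != w 0 l) ->
    [/\ node z i.+1 <= t <= node z i.+2, forall l, t != z 0 l &
     k (t - w 0 j) - k (t - z 0 j) <= k (s - w 0 j) - k (s - z 0 j)]).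
  have [lt_ij|le_ji] := ltnP i j.
    have ei : node z i = node w i by apply: agree; rewrite ltn_eqF// ltnS ltnW.
    have ei1 : node z i.+1 = node w i.+1 by exact: agree.
    have swj : s <= w 0 j.
      by rewrite -wj (le_trans si)// ei1 node_le// leqW.
    have sw l : s != w 0 l.
      have [->|lj] := eqVneq l j; last by rewrite -zw.
      apply: contraTneq (neq_node sz iN) => e; rewrite negbK eq_le si ei1 e.
      by rewrite -wj node_le// leqW.
    split=> //; split=> [|t it ti tw]; first by rewrite -ei -ei1 is_ si.
    have twj : t < w 0 j.
      by rewrite lt_neqAle tw -wj (le_trans ti)// node_le.
    have st : s <= t by rewrite (le_trans si)// ei1.
    split=> [|l|]; first by rewrite ei1 it (le_trans ti).
      have [->|lj] := eqVneq l j; last by rewrite zw.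
      by rewrite lt_eqF// (lt_trans twj).
    have := @increment_antitone _ _ kL (w 0 j - t) (w 0 j - s) (z 0 j - w 0 j)
      ltac:(lra) ltac:(lra) ltac:(lra) ltac:(lra).
    have -> : w 0 j - s + (z 0 j - w 0 j) = - (s - z 0 j) by ring.
    have -> : w 0 j - t + (z 0 j - w 0 j) = - (t - z 0 j) by ring.
    by rewrite -[w 0 j - s]opprB -[w 0 j - t]opprB !opprK; lra.
  have {le_ji} lt_ji : (j < i)%N by rewrite ltn_neqAle eq_sym ij.
  have ei1 : node z i.+1 = node w i.+1 by exact: agree.
  have ei2 : node z i.+2 = node w i.+2.
    by apply: agree; rewrite eqSS gtn_eqF// leqW.
  have szj : z 0 j < s.
    rewrite lt_neqAle eq_sym sz /= -zj (le_trans _ is_)//.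
    exact: node_le.
  have sw l : s != w 0 l.
    have [->|lj] := eqVneq l j; last by rewrite -zw.
    by rewrite gt_eqF// (lt_trans wz).
  split=> //; split=> [|t it ti tw].
    by rewrite (le_trans _ is_)//= -ei1.
  have ztj : z 0 j < t.
    by rewrite (lt_le_trans szj)// (le_trans si)// ei1.
  split=> [|l|]; first by rewrite ei1 ei2 it ti.
    have [->|lj] := eqVneq l j; last by rewrite zw.
    by rewrite gt_eqF.
  have st : s <= t by rewrite (le_trans si)// ei1.
  have t1 : t <= 1 by have := node_bounds i.+2 cw; lra.
  have := @increment_antitone _ _ kR (s - z 0 j) (t - z 0 j) (z 0 j - w 0 j)
    ltac:(lra) ltac:(lra) ltac:(lra) ltac:(lra).
  have -> : s - z 0 j + (z 0 j - w 0 j) = s - w 0 j by ring.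
  by have -> : t - z 0 j + (z 0 j - w 0 j) = t - w 0 j by ring.
have diff t : real_translates w t - real_translates z t =
    r j * (k (t - w 0 j) - k (t - z 0 j)).
  rewrite /real_translates -sumrB (bigD1 j)//= big1 ?addr0; first by ring.
  by move=> l lj; rewrite zw// subrr.
set d := real_translates w s - real_translates z s.
(* [d], possibly negative, is the decrease of the sum at [s]; at the points of
   the next interval the sum decreases by at most [d] *)
have h : (interval_sup w i.+1 <= interval_sup z i.+1 + d%:E)%E.
  apply: interval_sup_le => t it ti.
  have [->|Ft] := eqVneq (sum_translates r K J w t) -oo%E; first exact: leNye.
  have tw := sum_translates_neq_node Ft.
  have [/andP[zit zti] tz kk] := Ht t it ti tw.
  apply: (@le_trans _ _ (sum_translates r K J z t + d%:E)%E); last first.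
    by rewrite leeD2r// interval_sup_ub.
  have t0 : 0 <= t by have := node_bounds i.+1 cw; lra.
  have t1 : t <= 1 by have := node_bounds i.+2 cw; lra.
  rewrite !sum_translatesE// -addeA leeD2l// -EFinD lee_fin -lerBlDl.
  by rewrite /d !diff ler_wpM2l// ltW.
have /andP[s0 s1] := s01; case/andP: siw => wis wsi.
rewrite -(@leeD2rE _ d%:E)//; apply: le_trans h; apply: le_trans wi.
apply: le_trans (interval_sup_ub wis wsi).
by rewrite !sum_translatesE// -addeA leeD2l// -EFinD lee_fin /d; lra.
Qed.

Definition ascending : set 'rV[R]_n :=
  [set y | closed_simplex y /\
    forall i, (i < n)%N -> (interval_sup y i <= interval_sup y i.+1)%E].

(** At the node system 0 every interval but the last is reduced to a node. *)
Lemma ascending_nonempty : ascending !=set0.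
Proof.
have c0 : closed_simplex (0 : 'rV[R]_n).
  by split=> [i|i j _]; rewrite !mxE ?lexx ?ler01.
exists 0; split=> // i iN; apply: interval_sup_le => t it ti.
suff -> : t = (0 : 'rV[R]_n) 0 (Ordinal iN).
  by rewrite sum_translates_node leNye.
move: it ti; rewrite (node_coord _ (Ordinal iN)) mxE.
by have := node_bounds i c0; lra.
Qed.

Lemma closure_near (A : set 'rV[R]_n) (w : 'rV[R]_n) (P : 'rV[R]_n -> Prop) :
  closure A w -> (\forall z \near w, P z) -> exists2 z, A z & P z.
Proof. by move=> cl /cl[z [Az Pz]]; exists z. Qed.

Lemma closed_simplex_closed : closed (@closed_simplex R n).
Proof.
move=> w cl.
have ge0_lim (f : 'rV[R]_n -> R) : continuous f ->
    (forall z, closed_simplex z -> 0 <= f z) -> 0 <= f w.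
  move=> cf f0; rewrite leNgt; apply/negP => fw.
  have := @cvgr_lt _ _ _ (nbhs_filter w) _ _ (cf w) _ fw.
  by move=> /(closure_near cl)[z /f0]; lra.
split=> [i|i j ij].
  apply/andP; split.
    apply: (ge0_lim (fun z => z 0 i)) => [|z [z01 _]]; first exact: coord_continuous.
    by have := z01 i; lra.
  rewrite -subr_ge0; apply: (ge0_lim (fun z => 1 - z 0 i)) => [z|z [z01 _]].
    by apply: continuousB; [exact: cst_continuous|exact: coord_continuous].
  by have := z01 i; lra.
rewrite -subr_ge0; apply: (ge0_lim (fun z => z 0 j - z 0 i)) => [z|z [_ zz]].
  by apply: continuousB; exact: coord_continuous.
by rewrite subr_ge0 zz.
Qed.

Lemma ascending_closed (w : 'rV[R]_n) : closure ascending w -> ascending w.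
Proof.
move=> cl; have cw : closed_simplex w.
  by apply: closed_simplex_closed; apply: closureS cl => z [].
split=> // i iN; rewrite leNgt; apply/negP => /ereal_between[c [h1 h2]].
have u := interval_sup_usc (iN : (i.+1 <= n)%N) cw h1.
have l := interval_sup_lsc (ltnW iN) cw h2.
have [z [cz /(_ i iN) az] [zl zu]] := closure_near cl (filterI l u).
by have := lt_le_trans (zl cz) (le_trans az (zu cz)); rewrite ltxx.
Qed.

Lemma ascending_compact : compact ascending.
Proof.
pose A := [set v : 'rV[R]_n | forall i, `[0, 1]%classic (v ord0 i)].
apply: (@subclosed_compact _ _ A).
- exact: ascending_closed.
- apply: (@rV_compact R n (fun=> `[0, 1]%classic)) => i; exact: segment_compact.
- by move=> z [[z01 _] _] i; rewrite /= in_itv /=; exact: z01.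
Qed.

Lemma ascending_argmax : exists2 w, ascending w &
  forall y, ascending y -> \sum_(j < n) y 0 j <= \sum_(j < n) w 0 j.
Proof.
have cf : {within ascending, continuous (fun y : 'rV[R]_n => \sum_(j < n) y 0 j)}.
  apply: continuous_subspaceT; apply: continuous_big => [|j _].
    exact: add_continuous.
  exact: coord_continuous.
have [w wA wmax] := compact_EVT_max ascending_nonempty ascending_compact cf.
by exists w; [exact: set_mem|move=> y yA; apply: wmax; exact: mem_set].
Qed.

(** Only the node between the two unequal intervals is moved. It stays below the
next node because the second supremum exceeds -oo, so that its interval is not
reduced to a point. *)
Lemma raise_node_ascending (w : 'rV[R]_n) i (iN : (i < n)%N) : ascending w ->
    (interval_sup w i < interval_sup w i.+1)%E ->
  exists2 z, ascending z & \sum_(l < n) w 0 l < \sum_(l < n) z 0 l.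
Proof.
move=> [cw aw] /ereal_between[c [h1 h2]].
pose j := Ordinal iN; have wj : node w i.+1 = w 0 j := node_coord w j.
have gap : w 0 j < node w i.+2.
  have [t [it ti ct]] := interval_sup_gt h2.
  rewrite (lt_le_trans _ ti)// lt_neqAle -wj it andbT eq_sym neq_node//.
  by apply: sum_translates_neq_node; rewrite gt_eqF// (lt_trans _ ct)// ltNyr.
have l := interval_sup_lsc (iN : (i.+1 <= n)%N) cw h2.
have u := interval_sup_usc (ltnW iN) cw h1.
pose z (e : R) : 'rV[R]_n := w + e *: delta_mx 0 j.
have zj e : z e 0 j = w 0 j + e by rewrite !mxE !eqxx mulr1.
have zl e m : m != j -> z e 0 m = w 0 m.
  by move=> /negbTE mj; rewrite !mxE mj andbF mulr0 addr0.
have cvz : z e @[e --> 0] --> w.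
  rewrite -[X in _ --> X]addr0 -(scale0r (delta_mx 0 j)).
  apply: cvgD; first exact: cvg_cst.
  by apply: cvgZ; [exact: cvg_id|exact: cvg_cst].
have lu : nbhs w [set y : 'rV[R]_n | closed_simplex y ->
    (interval_sup y i <= interval_sup y i.+1)%E].
  by apply: filterS2 l u => y l u cy; rewrite (le_trans (u cy))// ltW// l.
have {}lu : \forall e \near (0 : R)^'+, closed_simplex (z e) ->
    (interval_sup (z e) i <= interval_sup (z e) i.+1)%E.
  exact: (cvg_at_right_filter cvz) lu.
have [e [e0 eg ez]] : exists e, [/\ 0 < e, e < node w i.+2 - w 0 j &
    closed_simplex (z e) -> (interval_sup (z e) i <= interval_sup (z e) i.+1)%E].
  have g0 : 0 < node w i.+2 - w 0 j by lra.
  near (0 : R)^'+ => e; exists e; split.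
  - by near: e; exact: nbhs_right_gt.
  - by near: e; exact: nbhs_right_lt.
  - by near: e; exact: lu.
have cz : closed_simplex (z e).
  have [w01 wm] := cw; split=> [m|m p mp].
    have [->|mj] := eqVneq m j; last by rewrite zl.
    by rewrite zj; have := node_bounds i.+2 cw; have := w01 j; lra.
  have [mj|mj] := eqVneq m j; have [pj|pj] := eqVneq p j.
  - by rewrite mj pj.
  - rewrite mj zj zl// -(node_coord w p); apply: (@le_trans _ _ (node w i.+2)); first lra.
    apply: node_le => //; move: mp pj; rewrite mj -val_eqE /= => ? ?.
    by rewrite ltnS ltn_neqAle eq_sym; apply/andP.
  - by rewrite pj zj zl//; have := wm m p mp; rewrite pj; lra.
  - by rewrite !zl// wm.
exists (z e).
  split=> // m mn; have [->|mi] := eqVneq m i; first exact: ez.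
  apply: (@off_diagonal w (z e) j) => //; last exact: aw.
    exact: zl.
  by rewrite zj; lra.
rewrite (bigD1 j)//= [ltRHS](bigD1 j)//= zj.
rewrite [X in _ < _ + X](eq_bigr (fun l => w 0 l)); first by lra.
by move=> m mj; exact: zl.
Unshelve. all: by end_near. Qed.

Lemma equioscillation_exists : exists2 w : 'rV[R]_n, closed_simplex w &
  forall i j, (i <= n)%N -> (j <= n)%N -> interval_sup w i = interval_sup w j.
Proof.
have [w aw wmax] := ascending_argmax; exists w; first by case: aw.
have step i : (i < n)%N -> interval_sup w i = interval_sup w i.+1.
  move=> iN; apply/eqP; rewrite eq_le; case: (aw) => _ -> //=.
  rewrite leNgt; apply/negP => /(raise_node_ascending iN aw)[z /wmax].
  by rewrite leNgt => /negP.
have from0 i : (i <= n)%N -> interval_sup w i = interval_sup w 0.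
  by elim: i => // i IH iN; rewrite -step// IH// ltnW.
by move=> i j iN jN; rewrite !from0.
Qed.
(** * Uniqueness of the equioscillation value and point *)

(** The [n] nodes cannot cover the more than [n] points where [J] is finite:
each point weighs at most 1. *)
Lemma finite_interval_exists y : closed_simplex y ->
  exists2 i, (i <= n)%N & interval_sup y i != -oo%E.
Proof.
move=> cy; case: J_field => _ [s [us sJ ns]].
have size_s : (n < size s)%N.
  rewrite -(ltr_nat R); apply: lt_le_trans ns _.
  rewrite -sum1_size natr_sum; apply: ler_sum => t _.
  rewrite /point_weight; case: ifP => _ /=; lra.
have [t ts ty] : exists2 t, t \in s & forall j, t != y 0 j.
  apply: contrapT => h; move: size_s; rewrite ltnNge => /negP; apply.
  rewrite -[X in (_ <= X)%N]card_ord -(size_codom (y 0)); apply: uniq_leq_size => // t ts.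
  apply: contrapT => ty; apply: h; exists t => // j.
  by apply/eqP => e; apply: ty; rewrite e codom_f.
have [] := sJ t ts; rewrite in_itv/= => /andP[t0 t1] Jt.
have ex0 : exists i, (i <= n)%N && (node y i <= t) by exists 0.
have [i /andP[iN it] imax] := ex_maxnP ex0 (fun i h => (andP h).1).
exists i => //.
have ti : t <= node y i.+1.
  have [iN'|ni] := ltnP i n.
    rewrite leNgt; apply/negP => /ltW ti.
    by have := imax i.+1; rewrite iN' ti => /(_ isT); rewrite ltnn.
  have -> : i = n by lia.
  by rewrite node_last.
have : (-oo < sum_translates r K J y t)%E.
  rewrite sum_translatesE// -(fineK Jt) -EFinD; exact: ltNyr.
by move=> h; rewrite gt_eqF// (lt_le_trans h)// interval_sup_ub.
Qed.

(** An interval reduced to a point is reduced to a node, where the sum is -oo. *)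
Lemma node_lt y i : (i <= n)%N -> closed_simplex y -> interval_sup y i != -oo%E ->
  node y i < node y i.+1.
Proof.
move=> iN cy yi; rewrite lt_neqAle node_le// andbT.
apply: contra yi => /eqP e; rewrite -leeNy_eq; apply: interval_sup_le => t it ti.
suff [j ->] : exists j, t = y 0 j by rewrite sum_translates_node.
have [iN'|ni] := ltnP i n.
  by exists (Ordinal iN'); rewrite -node_coord /=; apply: le_anti; rewrite ti -e it.
case: i iN e it ti ni => [|i] iN e it ti ni.
  have n0 : n = 0%N by lia.
  by move: e; rewrite -[in RHS]n0 node_last => /eqP; rewrite eq_sym oner_eq0.
by exists (Ordinal iN); rewrite -node_coord /=; apply: le_anti; rewrite it e ti.
Qed.

Lemma open_simplex_finite y : closed_simplex y ->
  (forall i, (i <= n)%N -> interval_sup y i != -oo%E) -> open_simplex y.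
Proof.
move=> cy fy; have lt i : (i <= n)%N -> node y i < node y i.+1.
  by move=> iN; apply: node_lt => //; exact: fy.
split=> [i|i j ij]; rewrite -!node_coord.
  apply/andP; split.
    by apply: lt_le_trans (lt 0 isT) _; exact: node_le.
  by rewrite -(node_last y); apply: le_lt_trans (lt n (leqnn n)); exact: node_le.
by apply: lt_le_trans (lt i.+1 _) _; [exact: ltn_ord|exact: node_le].
Qed.

Lemma drift_argmax x y : exists2 m, (m <= n)%N &
  forall l, (l <= n)%N -> drift x y l <= drift x y m.
Proof.
have [m _ Hm] := @arg_maxP _ _ _ ord0 xpredT (fun i : 'I_n.+1 => drift x y i) isT.
exists m => [|l ln]; first by rewrite -ltnS.
by have := Hm (Ordinal (ln : (l < n.+1)%N)) isT.
Qed.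

Lemma interval_sup_intertwining x y : closed_simplex x -> closed_simplex y ->
  exists2 m, (m <= n)%N & (interval_sup y m <= interval_sup x m)%E.
Proof.
move=> cx cy; have [m mn Hm] := drift_argmax x y; exists m => //.
apply: interval_sup_le => t mt tm.
have [h _] := translates_dominated cx cy mn Hm mt tm.
apply: le_trans h (interval_sup_ub _ _).
  by apply: le_trans mt; case: (drift_argmax_itv mn Hm).
by apply: (le_trans tm); case: (drift_argmax_itv mn Hm).
Qed.

Lemma interval_sup_lt_pinfty y i : (i <= n)%N -> closed_simplex y ->
  (interval_sup y i < +oo)%E.
Proof.
move=> iN cy; case: J_field => [[B JB] _]; have [_ mR _] := kR; have [_ mL _] := kL.
pose M := Num.max (k 1) (k (- 1)).
have kM u : -1 <= u -> u <= 1 -> (kernel_ext K u <= M%:E)%E.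
  move=> u1 u2; have [->|u0] := eqVneq u 0; first by rewrite k0 leNye.
  rewrite kernel_extE// lee_fin /M le_max.
  move: u0; rewrite neq_lt => /orP[u0|u0]; apply/orP; [right|left].
    by have := mL (- u) 1; rewrite opprK; apply; lra.
  exact: mR.
apply: (@le_lt_trans _ _ (B + \sum_(j < n) r j * M)%:E); last exact: ltry.
apply: interval_sup_le => t it ti.
have t0 : 0 <= t by have := node_bounds i cy; lra.
have t1 : t <= 1 by have := node_bounds i.+1 cy; lra.
rewrite EFinD -sumEFin; apply: leeD; first by apply: JB; rewrite in_itv/= t0.
apply: lee_sum => j _; rewrite EFinM lee_pmul2l ?lte_fin//.
by case: cy => /(_ j) ? _; apply: kM; lra.
Qed.

(** [equioscillation] in terms of [interval_sup]. *)
Definition equioscillating (y : 'rV[R]_n) : Prop := closed_simplex y /\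
  forall i j, (i <= n)%N -> (j <= n)%N -> interval_sup y i = interval_sup y j.

Lemma equioscillating_finite y i : equioscillating y -> (i <= n)%N ->
  interval_sup y i != -oo%E.
Proof.
move=> [cy ey] iN; have [j jN] := finite_interval_exists cy.
by rewrite (ey i j).
Qed.

Lemma equioscillating_le x y i : closed_simplex x -> equioscillating y -> (i <= n)%N ->
  exists2 m, (m <= n)%N & (interval_sup y i <= interval_sup x m)%E.
Proof.
move=> cx [cy ey] iN; have [m mn h] := interval_sup_intertwining cx cy.
by exists m => //; rewrite (ey i m).
Qed.

Lemma equioscillating_ge x y i : closed_simplex x -> equioscillating y -> (i <= n)%N ->
  exists2 m, (m <= n)%N & (interval_sup x m <= interval_sup y i)%E.
Proof.
move=> cx [cy ey] iN; have [m mn h] := interval_sup_intertwining cy cx.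
by exists m => //; rewrite (ey i m).
Qed.

Lemma equioscillation_value_unique x y i j : equioscillating x -> equioscillating y ->
  (i <= n)%N -> (j <= n)%N -> interval_sup x i = interval_sup y j.
Proof.
move=> ex ey iN jN; apply/eqP; rewrite eq_le; apply/andP; split.
  have [m mn h] := equioscillating_le ey.1 ex iN.
  by rewrite (ey.2 j m).
have [m mn h] := equioscillating_le ex.1 ey jN.
by rewrite (ex.2 i m).
Qed.

Hypothesis k_strict : forall p q, 0 < p -> p < q -> q <= 1 -> k p < k q.

(** A positive drift would make the sum for [x] strictly larger than the sum for
[y] at a point where the latter attains the common equioscillation value. *)
Lemma equioscillating_drift_le0 x y l : equioscillating x -> equioscillating y ->
  (l <= n)%N -> drift x y l <= 0.
Proof.
move=> ex ey ln; have [m mn Hm] := drift_argmax x y.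
apply: le_trans (Hm l ln) _; rewrite leNgt; apply/negP => dm.
have [cx cy] := (ex.1, ey.1).
have Efin : interval_sup y m \is a fin_num.
  by rewrite fin_numE (equioscillating_finite ey)//= lt_eqF// interval_sup_lt_pinfty.
have [t [mt tm yt]] := interval_sup_attained mn cy (esym (fineK Efin)).
have [_ lt] := translates_dominated cx cy mn Hm mt tm.
have {lt} := lt k_strict dm; rewrite yt => /(_ isT).
rewrite fineK// -(equioscillation_value_unique ex ey mn mn) ltNge.
rewrite interval_sup_ub//.
  by apply: le_trans mt; case: (drift_argmax_itv mn Hm).
by apply: (le_trans tm); case: (drift_argmax_itv mn Hm).
Qed.

Lemma equioscillating_unique x y : equioscillating x -> equioscillating y -> x = y.
Proof.
move=> ex ey.
have dN l : drift x y l = - drift y x l.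
  by rewrite /drift -sumrN; apply: eq_bigr => i _; ring.
have d0 l : (l <= n)%N -> drift x y l = 0.
  move=> ln; apply: le_anti; rewrite (equioscillating_drift_le0 ex ey ln) /=.
  by rewrite dN oppr_ge0 (equioscillating_drift_le0 ey ex ln).
apply/rowP => j; have jn := ltn_ord j.
have := d0 j.+1 jn; rewrite /drift big_ord_recr /= -/(drift x y j) (d0 j (ltnW jn)) add0r.
move/eqP; rewrite mulf_eq0 gt_eqF ?weight_gt0//= subr_eq0 !node_coord.
by move/eqP.
Qed.
End sum_of_translates.

(** * The minimax theorem *)

Theorem corollary3p2 (R : realType) (n : nat) (r : 'I_n -> R)
    (K : R -> R) (J : R -> \bar R)
    (r_gt0 : forall j, 0 < r j)
    (K_kernel : is_kernel K)
    (K_singular : singular K)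
    (K_monotone : monotone_kernel K)
    (J_field : is_field_function n J)
    (J_usc : upper_semicontinuous_on `[0, 1] J) :
  minimax r K J = maximin r K J /\
  (exists w : 'rV[R]_n,
    [/\ closed_simplex w,
        regularity_set r K J w,
        equioscillation r K J w,
        [/\ min_sup r K J w = maximin r K J,
            maximin r K J = minimax r K J &
            minimax r K J = max_sup r K J w] &
        strictly_monotone_kernel K ->
          forall y : 'rV[R]_n, equioscillation r K J y -> y = w]) /\
  (forall x : 'rV[R]_n, open_simplex x ->
    [/\ (min_sup r K J x <= minimax r K J)%E,
        minimax r K J = maximin r K J &
        (maximin r K J <= max_sup r K J x)%E]) /\
  (forall y : 'rV[R]_n, equioscillation r K J y ->
    forall j : 'I_n.+1, local_sup r K J y j = minimax r K J).
Proof.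
have [kR kL k0 kpos kneg] := kernel_ext_singular K_kernel K_singular K_monotone.
have equioscillationE y : equioscillation r K J y <-> equioscillating r K J y.
  split=> -[cy ey]; split=> // i j.
    by move=> iN jN; exact: (ey (Ordinal (iN : (i < n.+1)%N)) (Ordinal (jN : (j < n.+1)%N))).
  by apply: ey; rewrite -ltnS.
have [w cw w_eq] :=
  equioscillation_exists r_gt0 kR kL k0 kpos kneg J_field J_usc.
have ew : equioscillating r K J w by [].
have fw i : (i <= n)%N -> interval_sup r K J w i != -oo%E.
  exact: equioscillating_finite.
have ow : open_simplex w by apply: open_simplex_finite fw.
pose v := interval_sup r K J w 0.
have wv (j : 'I_n.+1) : local_sup r K J w j = v by apply: w_eq; rewrite // -ltnS.
have le_max x : closed_simplex x -> (v <= max_sup r K J x)%E.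
  move=> cx; have [m mn h] := equioscillating_le r_gt0 kR kL k0 kpos kneg cx ew (leq0n n).
  by apply: le_trans h _; exact: (le_bigmax _ _ (Ordinal (mn : (m < n.+1)%N))).
have min_le x : closed_simplex x -> (min_sup r K J x <= v)%E.
  move=> cx; have [m mn h] := equioscillating_ge r_gt0 kR kL k0 kpos kneg cx ew (leq0n n).
  by apply: le_trans _ h; exact: (bigmin_le _ (Ordinal (mn : (m < n.+1)%N))).
have max_w : max_sup r K J w = v.
  apply: le_anti; rewrite le_max// andbT.
  by apply: bigmax_le => [|j _]; [exact: leNye|rewrite wv].
have min_w : min_sup r K J w = v.
  apply: le_anti; rewrite min_le//=.
  by apply: le_bigmin => [|j _]; [exact: leey|rewrite wv].
have minimaxE : minimax r K J = v.
  apply: le_anti; apply/andP; split.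
    by rewrite -max_w; apply: ereal_inf_lbound; exists w.
  by apply: le_ereal_inf_tmp => _ [x ox <-]; apply: le_max; exact: open_simplex_closed.
have maximinE : maximin r K J = v.
  apply: le_anti; apply/andP; split; last first.
    by rewrite -min_w; apply: ereal_sup_ubound; exists w.
  by apply: ge_ereal_sup => _ [x ox <-]; apply: min_le; exact: open_simplex_closed.
rewrite minimaxE maximinE; split=> //; split; last split.
- exists w; split=> //.
  + by split=> // j; apply: fw; rewrite -ltnS.
  + exact/equioscillationE.
  + move=> [_ K_strict] y /equioscillationE ey.
    apply: (equioscillating_unique r_gt0 kR kL k0 kpos kneg J_field J_usc _ ey ew).
    move=> p q p0 pq q1; have p1 : p <= 1 by lra.
    have q0 : 0 < q by lra.
    have := K_strict p q; rewrite !in_itv/= p0 p1 q0 q1 => /(_ isT isT pq).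
    by rewrite !kpos.
- move=> x /open_simplex_closed cx; split=> //; [exact: min_le|exact: le_max].
- move=> y /equioscillationE ey j.
  by apply: equioscillation_value_unique => //; rewrite -ltnS.
Qed.
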